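(* Let $p$ be a prime and let $(A,+,\cdot)$ be a pre-Lie algebra over $\mathbb{F}_p$ with $(A,+)\cong C_p^5$, generated by a single element $x$ as a pre-Lie algebra. Suppose $A^{[4]}\neq 0$, $A^{[5]}=0$ and $\dim_{\mathbb{F}_p}A^{[4]}=1$. Then the following hold. (1) There exist $u\in\{x^2\cdot x,\ x\cdot x^2\}$ and $a\in\{u\cdot x,\ x\cdot u\}$ such that $\{x,\ x^2,\ x^2\cdot x,\ x\cdot x^2,\ a\}$ is a basis of $A$ as an $\mathbb{F}_p$-vector space. (2) $\dim_{\mathbb{F}_p}A^{[3]}/A^{[4]}=2$.
   Context: A pre-Lie algebra over $\mathbb{F}_p$ is an $\mathbb{F}_p$-vector space $A$ with a bilinear product $\cdot$ satisfying $(a\cdot b)\cdot c-a\cdot(b\cdot c)=(b\cdot a)\cdot c-b\cdot(a\cdot c)$ for all $a,b,c\in A$. For subspaces $B,C\subseteq A$, $B\cdot C$ denotes the subspace spanned by all $b\cdot c$ with $b\in B$, $c\in C$. Define $A^{[1]}=A$ and $A^{[i+1]}=\sum_{j=1}^{i}A^{[j]}\cdot A^{[i+1-j]}$ for $i\ge 1$. Write $x^2=x\cdot x$. *)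

(* Defs.v *)
From HB Require Import structures.
From mathcomp Require Import all_boot all_order all_fingroup all_algebra.

Set Implicit Arguments.
Unset Strict Implicit.
Unset Printing Implicit Defensive.

Import GRing.Theory.
Local Open Scope ring_scope.

Section PreLie.

Variables (K : fieldType) (A : vectType K) (mul : {bilinear A -> A -> A}).

Definition prelie : Prop :=
  forall a b c : A,
    mul (mul a b) c - mul a (mul b c) = mul (mul b a) c - mul b (mul a c).

(* Spanned by the products of basis vectors; [subprodvP] shows that this is
   the span of all products of an element of B by an element of C. *)
Definition subprodv (B C : {vspace A}) : {vspace A} :=
  <<[seq mul b c | b <- vbasis B, c <- vbasis C]>>%VS.

Lemma memv_subprod (B C : {vspace A}) b c :
  b \in B -> c \in C -> mul b c \in subprodv B C.
Proof.
move=> /coord_vbasis-> /coord_vbasis->.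
rewrite linear_sumlz memv_suml // => i _; rewrite linear_sumr memv_suml // => j _.
rewrite linearZl_LR linearZr_LR /= !memvZ // memv_span //.
by apply/allpairsP; exists ((vbasis B)`_i, (vbasis C)`_j); rewrite !memt_nth.
Qed.

Lemma subprodvP (B C W : {vspace A}) :
  reflect (forall b c, b \in B -> c \in C -> mul b c \in W)
          (subprodv B C <= W)%VS.
Proof.
apply: (iffP idP) => [sBCW b c Bb Cc | sBCW].
  by rewrite (subvP sBCW) ?memv_subprod.
apply/span_subvP => _ /allpairsP[[b c] /= [Bb Cc ->]].
by rewrite sBCW ?vbasis_mem.
Qed.

(* [:: A^[1]; ...; A^[n]] *)
Fixpoint brpowers (n : nat) : seq {vspace A} :=
  if n is m.+1 then
    let s := brpowers m in
    rcons s (if m is 0 then fullv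
             else \sum_(1 <= j < m.+1)
                    subprodv (nth 0%VS s (j - 1)) (nth 0%VS s (m - j)))%VS
  else [::].

(* A^[i] for i >= 1; the value at i = 0 is a dummy. *)
Definition brpow (i : nat) : {vspace A} := nth 0%VS (brpowers i) i.-1.

Lemma size_brpowers n : size (brpowers n) = n.
Proof. by elim: n => //= n IHn; rewrite size_rcons IHn. Qed.

Lemma nth_brpowers n i :
  (i < n)%N -> nth 0%VS (brpowers n) i = brpow i.+1.
Proof.
elim: n => // n IHn; rewrite ltnS leq_eqVlt => /predU1P[-> // | lt_in].
by rewrite [LHS]/= nth_rcons size_brpowers lt_in IHn.
Qed.

Lemma brpow1 : brpow 1 = fullv.
Proof. by []. Qed.

Lemma brpowS i : (0 < i)%N ->
  brpow i.+1 = (\sum_(1 <= j < i.+1) subprodv (brpow j) (brpow (i.+1 - j)))%VS.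
Proof.
case: i => // i _; rewrite {1}/brpow [brpowers _]/= nth_rcons.
rewrite -[rcons _ _]/(brpowers i.+1) size_brpowers ltnn eqxx.
apply: eq_big_nat => j /andP[j_gt0 le_ji].
rewrite !nth_brpowers; last first.
- by rewrite subn1 prednK.
- by rewrite ltn_subrL j_gt0.
by rewrite subn1 prednK // -subSn.
Qed.

Definition generated_by (x : A) : Prop :=
  forall B : {vspace A},
    x \in B -> (forall b c, b \in B -> c \in B -> mul b c \in B) -> B = fullv.

End PreLie.

(* The dimension of U / V for V <= U: the quotient is represented by a
   complement of V in U. By [dimv_quot_limg] this is the dimension of the
   image of U under any linear map with kernel V. *)
Definition dimv_quot (K : fieldType) (A : vectType K) (U V : {vspace A}) : nat :=
  \dim (U :\: V).

Lemma dimv_quot_limg (K : fieldType) (A Q : vectType K) (f : 'Hom(A, Q))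
    (U V : {vspace A}) :
  lker f = V -> \dim (f @: U) = dimv_quot U V.
Proof.
move=> <-; apply: (@addnI (\dim (U :&: lker f))).
by rewrite limg_ker_dim dimv_cap_compl.
Qed.

(* Main.v *)
Require Import Defs.
From HB Require Import structures.
From mathcomp Require Import all_boot all_order all_fingroup all_algebra.

Set Implicit Arguments.
Unset Strict Implicit.
Unset Printing Implicit Defensive.

Import GRing.Theory.
Local Open Scope ring_scope.

(** The powers A^[n] behave like a grading up to higher terms. If A^[i] and
A^[j] are spanned by finite sets X and Y modulo A^[i+1] and A^[j+1], then the
product of two of their elements lies in the span of the products X * Y, up
to A^[i+j+1] ([brpowM_layer]). As x generates A, the subspace <x> + A^[2] is
everything, and so A^[n] is spanned modulo A^[n+1] by the products of n
factors x. This gives one vector x in degree 1, one vector x^2 in degree 2,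
and the two vectors x^2 x and x x^2 in degree 3.

In degree 4 the products are u x and x u with u in {x^2 x, x x^2}, together
with x^2 x^2. The pre-Lie identity for the triple (x^2, x, x) writes the last
one as a combination of the others ([prelie_sq_sq]). As A^[5] = 0 and A^[4]
is a line, some nonzero a among the u x and x u spans A^[4], and the five
vectors x, x^2, x^2 x, x x^2, a span A. Since A has dimension 5 they form a
basis. The last three of them span A^[3], which therefore has dimension 3,
and its quotient by the line A^[4] has dimension 2. *)

(** * Spanning A^[n] modulo A^[n+1] *)

Section Layers.

Variables (K : fieldType) (A : vectType K) (mul : {bilinear A -> A -> A}).

Lemma mem_brpowM i j b c :
    (0 < i)%N -> (0 < j)%N -> b \in brpow mul i -> c \in brpow mul j ->
  mul b c \in brpow mul (i + j).
Proof.
case: i j => // i [//|j] _ _ bAi cAj; rewrite addnS brpowS //.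
have lt_i : i.+1 \in index_iota 1 (i.+1 + j).+1.
  by rewrite mem_index_iota /= ltnS leq_addr.
rewrite (big_rem i.+1) //=; rewrite (subvP (addvSl _ _)) // memv_subprod //.
by rewrite -addnS addKn.
Qed.

(** A shift of indices: [i + j = n] over the naturals stands for the degrees
i + 1 and j + 1, so the positivity side conditions of the recursion vanish and
the finitely many cases for a concrete n can be enumerated by matching. *)
Lemma brpowS_sub n (W : {vspace A}) :
    (forall i j b c, (i + j = n)%N ->
       b \in brpow mul i.+1 -> c \in brpow mul j.+1 -> mul b c \in W) ->
  (brpow mul n.+2 <= W)%VS.
Proof.
move=> sW; rewrite brpowS // big_seq_cond.
elim/big_ind: _ => [|U V sUW sVW|[|j]]; first exact: sub0v.
- by rewrite subv_add sUW.
- by rewrite mem_index_iota.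
rewrite mem_index_iota andbT ltnS => /andP[_ lejn].
apply/subprodvP => b c; rewrite subSn // => bA cA.
by apply: sW bA cA; rewrite subnKC.
Qed.

Lemma memv_mul_span (X Y : seq A) b c :
    b \in <<X>>%VS -> c \in <<Y>>%VS ->
  mul b c \in <<[seq mul u v | u <- X, v <- Y]>>%VS.
Proof.
rewrite -[X]/(val (in_tuple X)) -[Y]/(val (in_tuple Y)).
move=> /coord_span-> /coord_span->.
rewrite linear_sumlz memv_suml // => i _.
rewrite linear_sumr memv_suml // => j _.
rewrite linearZl_LR linearZr_LR /= !memvZ // memv_span //.
by apply/allpairsP; exists (X`_i, Y`_j); rewrite !mem_nth.
Qed.

(** With b = u + b' and c = v + c', the terms u c' and b' c have degree at
least i + j + 1, so only u v matters. The list Z leaves room to replace the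
list of products by a more convenient one. *)
Lemma brpowM_layer i j (X Y Z : seq A) b c :
    (0 < i)%N -> (0 < j)%N -> (<<X>> <= brpow mul i)%VS ->
    (brpow mul i <= <<X>> + brpow mul i.+1)%VS ->
    (brpow mul j <= <<Y>> + brpow mul j.+1)%VS ->
    {subset [seq mul u v | u <- X, v <- Y] <= Z} ->
    b \in brpow mul i -> c \in brpow mul j ->
  mul b c \in (<<Z>> + brpow mul (i + j).+1)%VS.
Proof.
move=> i0 j0 sX sAi sAj sZ bAi cAj.
have /memv_addP[u uX [b' b'A def_b]] := subvP sAi b bAi.
have /memv_addP[v vY [c' c'A def_c]] := subvP sAj c cAj.
have -> : mul b c = mul u v + (mul u c' + mul b' c).
  by rewrite addrA -linearDr -def_c -linearDl -def_b.
rewrite memv_add ?(subvP (sub_span sZ)) ?memv_mul_span // rpredD //.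
  by rewrite -addnS mem_brpowM // (subvP sX).
by rewrite -addSn mem_brpowM.
Qed.

Variables (x : A) (x_gen : generated_by mul x).

Let x2 := mul x x.
Let x2x := mul x2 x.
Let xx2 := mul x x2.

(** The right-hand side contains x, and it is a subalgebra because it contains
all products, which are in A^[2]. *)
Lemma generator_layer1 : (brpow mul 1 <= <<[:: x]>> + brpow mul 2)%VS.
Proof.
rewrite brpow1 -(x_gen (B := (<<[:: x]>> + brpow mul 2)%VS)) //.
  by rewrite (subvP (addvSl _ _)) // memv_span1.
move=> b c _ _; rewrite (subvP (addvSr _ _)) //.
by apply: (@mem_brpowM 1 1) => //; rewrite brpow1 memvf.
Qed.

Lemma mem_x2 : x2 \in brpow mul 2.
Proof. by apply: (@mem_brpowM 1 1) => //; rewrite brpow1 memvf. Qed.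

Lemma mem_x2x : x2x \in brpow mul 3.
Proof. by apply: (@mem_brpowM 2 1) => //; rewrite ?mem_x2 ?brpow1 ?memvf. Qed.

Lemma mem_xx2 : xx2 \in brpow mul 3.
Proof. by apply: (@mem_brpowM 1 2) => //; rewrite ?mem_x2 ?brpow1 ?memvf. Qed.

Lemma generator_layer2 : (brpow mul 2 <= <<[:: x2]>> + brpow mul 3)%VS.
Proof.
apply: brpowS_sub => -[|i] [|j] b c // _.
have L1 := generator_layer1.
by apply: (brpowM_layer _ _ _ L1 L1); rewrite ?subvf.
Qed.

Lemma generator_layer3 :
  (brpow mul 3 <= <<[:: x2x; xx2]>> + brpow mul 4)%VS.
Proof.
have L1 := generator_layer1; have L2 := generator_layer2.
apply: brpowS_sub => -[|[|i]] [|[|j]] b c // _.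
- apply: (brpowM_layer _ _ _ L1 L2); rewrite ?subvf //.
  by move=> z; rewrite !inE => ->; rewrite ?orbT.
- apply: (brpowM_layer _ _ _ L2 L1) => //.
    by rewrite span_seq1 -memvE mem_x2.
  by move=> z; rewrite !inE => ->; rewrite ?orbT.
Qed.

(** The pre-Lie identity for the triple (x^2, x, x). It is what allows the
element a of the basis to be always of the form u x or x u. *)
Lemma prelie_sq_sq : prelie mul ->
  mul x2 x2 = mul x2x x - mul xx2 x + mul x x2x.
Proof.
move=> /(_ x2 x x) E; rewrite -/x2 -/x2x -/xx2 in E.
by rewrite -[LHS](subKr (mul x2x x)) E opprB addrA addrAC.
Qed.

Lemma generator_layer4 : prelie mul ->
  (brpow mul 4
     <= <<[:: mul x2x x; mul x x2x; mul xx2 x; mul x xx2]>> + brpow mul 5)%VS.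
Proof.
move=> A_prelie; set Z := [:: _; _; _; _].
have L1 := generator_layer1; have L2 := generator_layer2.
have L3 := generator_layer3.
have memZ z : z \in Z -> z \in <<Z>>%VS by apply: memv_span.
have Zx2 : mul x2 x2 \in <<Z>>%VS.
  by rewrite prelie_sq_sq // rpredD ?rpredB ?memZ // !inE eqxx ?orbT.
have sub13 : {subset [seq mul u v | u <- [:: x], v <- [:: x2x; xx2]] <= Z}.
  by move=> z; rewrite !inE => /orP[] ->; rewrite ?orbT.
have sub31 : {subset [seq mul u v | u <- [:: x2x; xx2], v <- [:: x]] <= Z}.
  by move=> z; rewrite !inE => /orP[] ->; rewrite ?orbT.
apply: brpowS_sub => -[|[|[|i]]] [|[|[|j]]] b c // _ bA cA.
- by apply: (brpowM_layer _ _ _ L1 L3); rewrite ?subvf.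
(* A^[2] A^[2] contributes only x^2 x^2, which is in the span of Z. *)
- apply: (subvP _ _ (brpowM_layer _ _ _ L2 L2 (fun=> id) bA cA)) => //.
    by rewrite addvS // span_seq1 -memvE.
  by rewrite span_seq1 -memvE mem_x2.
- apply: (brpowM_layer _ _ _ L3 L1) => //.
  by rewrite span_cons span_seq1 subv_add -!memvE mem_x2x mem_xx2.
Qed.

End Layers.

(** * Counting dimensions *)

(** An additive map is linear over F_p since every scalar is a multiple
of 1. *)
Lemma dimvf_additive_bij p n (A : vectType 'F_p)
    (f : {additive A -> 'rV['F_p]_n}) :
  bijective f -> \dim {:A} = n.
Proof.
case=> g fK gK.
have f_lin : linear f.
  by move=> k u v; rewrite raddfD -[k]natr_Zp !scaler_nat raddfMn.
pose F : {linear A -> 'rV['F_p]_n} :=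
  HB.pack (f : A -> _) (GRing.isLinear.Build _ _ _ _ _ f_lin).
have ker0 : lker (linfun F) == 0%VS.
  apply/lker0P => u v; rewrite !lfunE /=; exact: (can_inj fK).
have im : limg (linfun F) = fullv.
  apply/vspaceP => w; rewrite memvf -[w]gK.
  by have := memv_img (linfun F) (memvf (g w)); rewrite lfunE.
have := @limg_dim_eq _ _ _ (linfun F) fullv; rewrite im (eqP ker0) capv0.
by move=> <- //; rewrite dimvf dim_matrix; apply: mul1n.
Qed.

Theorem theorem4p4p1 (p : nat) (p_prime : prime p)
    (A : vectType 'F_p) (mul : {bilinear A -> A -> A}) (A_prelie : prelie mul)
    (A_Cp5 : exists f : {additive A -> 'rV['F_p]_5}, bijective f)
    (x : A) (x_gen : generated_by mul x)
    (A4_neq0 : brpow mul 4 <> 0%VS) (A5_eq0 : brpow mul 5 = 0%VS)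
    (dimA4 : \dim (brpow mul 4) = 1%N) :
  (exists u a : A,
     [/\ u \in [:: mul (mul x x) x; mul x (mul x x)],
         a \in [:: mul u x; mul x u] &
         basis_of fullv
           [:: x; mul x x; mul (mul x x) x; mul x (mul x x); a]])
  /\ dimv_quot (brpow mul 3) (brpow mul 4) = 2%N.
Proof.
have [f /dimvf_additive_bij dimA] := A_Cp5.
have L1 := generator_layer1 x_gen; have L2 := generator_layer2 x_gen.
have L3 := generator_layer3 x_gen.
have L4 := generator_layer4 x_gen A_prelie; rewrite A5_eq0 addv0 in L4.
set Z4 := [:: _; _; _; _] in L4.
have A3l : mul (mul x x) x \in brpow mul 3 by apply: mem_x2x.
have A3r : mul x (mul x x) \in brpow mul 3 by apply: mem_xx2.
have [u [a [u_in a_in a_neq0]]] : exists u a : A,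
    [/\ u \in [:: mul (mul x x) x; mul x (mul x x)],
        a \in [:: mul u x; mul x u] & a != 0].
  case/boolP: (has (predC1 0) Z4) => [/hasP[a Z4a a_neq0] | /hasPn Z4_0].
    move: Z4a; rewrite !inE orbA => /orP[] a_in;
      [exists (mul (mul x x) x) | exists (mul x (mul x x))]; exists a;
      by split; rewrite // !inE ?eqxx ?orbT.
  case: A4_neq0; apply/eqP; rewrite -subv0 (subv_trans L4) //.
  by apply/span_subvP => z /Z4_0; rewrite memv0 negbK.
have uA3 : u \in brpow mul 3 by move: u_in; rewrite !inE => /orP[] /eqP->.
have aA4 : a \in brpow mul 4.
  move: a_in; rewrite !inE => /orP[] /eqP->.
    by apply: (@mem_brpowM _ _ _ 3 1) => //; rewrite brpow1 memvf.
  by apply: (@mem_brpowM _ _ _ 1 3) => //; rewrite brpow1 memvf.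
have A4E : brpow mul 4 = <[a]>%VS.
  by apply/esym/eqP; rewrite eqEdim -memvE aA4 dim_vline a_neq0 dimA4.
(* A^[4] is in A^[3]: as a product, u is also in A^[2], and this puts the
   spanning vector a of A^[4] in A^[3] as well. *)
have uA2 : u \in brpow mul 2.
  move: u_in; rewrite !inE => /orP[] /eqP->;
    by apply: (@mem_brpowM _ _ _ 1 1) => //; rewrite brpow1 memvf.
have aA3 : a \in brpow mul 3.
  move: a_in; rewrite !inE => /orP[] /eqP->.
    by apply: (@mem_brpowM _ _ _ 2 1) => //; rewrite brpow1 memvf.
  by apply: (@mem_brpowM _ _ _ 1 2) => //; rewrite brpow1 memvf.
have bas : basis_of fullv
    [:: x; mul x x; mul (mul x x) x; mul x (mul x x); a].
  rewrite basisEdim dimA leqnn andbT -(brpow1 mul).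
  apply: (subv_trans L1); rewrite span_seq1 span_cons addvS //.
  apply: (subv_trans L2); rewrite span_seq1 span_cons addvS //.
  apply: (subv_trans L3); rewrite A4E -span_seq1 -span_cat; exact: subvv.
split; first by exists u, a.
have A3E : brpow mul 3 = <<[:: mul (mul x x) x; mul x (mul x x); a]>>%VS.
  apply/eqP; rewrite eqEsubv !span_cons span_nil addv0 !subv_add -!memvE.
  rewrite A3l A3r aA3 andbT (subv_trans L3) // A4E span_cons span_seq1 addvA.
  exact: subvv.
have free3 : free [:: mul (mul x x) x; mul x (mul x x); a].
  exact: (@catr_free _ _ [:: x; mul x x]) (basis_free bas).
have := dimv_cap_compl (brpow mul 3) (brpow mul 4).
rewrite (capv_idPr _) ?dimA4; last by rewrite A4E -memvE.
by rewrite {2}A3E (eqP free3) => -[].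
Qed.
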